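(* Let $n\ge 1$ and let $G<\widehat{\mathrm{Diff}}(\mathbb C^n,0)$ be an abelian subgroup of formal diffeomorphisms. Then at least one of the following holds: (1) $G$ admits an invariant non-zero formal vector field $\hat X\in\hat{\mathcal X}(\mathbb C^n,0)$; (2) $G_{\mathrm{Id}}=\{\mathrm{Id}\}$, i.e. the only element of $G$ tangent to the identity is the identity.
   Context: $\widehat{\mathrm{Diff}}(\mathbb C^n,0)$ is the group (under composition) of formal diffeomorphisms of $\mathbb C^n$ fixing the origin: $n$-tuples $\hat f=\hat f'(0)z+\sum_{j\ge2}f_j(z)$ of formal power series in $z=(z_1,\dots,z_n)$, with $\hat f'(0)\in GL(n,\mathbb C)$ and $f_j$ a vector of homogeneous polynomials of degree $j$. $\hat f$ is tangent to the identity if $\hat f'(0)=\mathrm{Id}$; $G_{\mathrm{Id}}$ is the subgroup of elements of $G$ tangent to the identity. $\hat{\mathcal X}(\mathbb C^n,0)$ is the set of formal vector fields $\sum \hat a_j\,\partial/\partial z_j$, $\hat a_j\in\mathbb C[[z_1,\dots,z_n]]$, vanishing at the origin. $\hat X$ is $G$-invariant if $\hat g_*\hat X=\hat X$ for all $\hat g\in G$, where $\hat g_*\hat X=(D\hat g\cdot\hat X)\circ\hat g^{-1}$. *)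

(* Defs.v *)
From HB Require Import structures.
From mathcomp Require Import all_boot all_order all_algebra.
From mathcomp Require Import boolp classical_sets reals complex mpoly.

Set Implicit Arguments.
Unset Strict Implicit.
Unset Printing Implicit Defensive.

Import GRing.Theory.
Local Open Scope ring_scope.

(* K[[z_1, ..., z_n]]: a series is the family of its coefficients, indexed by
   the multi-exponents 'X_{1..n}. *)
Record fps (n : nat) (K : Type) := Fps { fps_coef :> 'X_{1..n} -> K }.

HB.instance Definition _ n K := gen_eqMixin (fps n K).
HB.instance Definition _ n K := gen_choiceMixin (fps n K).

Lemma fpsP n K (f g : fps n K) : (forall m, f m = g m) <-> f = g.
Proof.
by split=> [|-> //]; case: f g => [f] [g] /= /funext ->.
Qed.

Section Zmodule.
Variables (n : nat) (K : nzRingType).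
Implicit Types f g h : fps n K.

Definition fps0 : fps n K := Fps (fun=> 0).
Definition fps_opp f : fps n K := Fps (fun m => - f m).
Definition fps_add f g : fps n K := Fps (fun m => f m + g m).

Lemma fps_addA : associative fps_add.
Proof. by move=> f g h; apply/fpsP => m /=; rewrite addrA. Qed.
Lemma fps_addC : commutative fps_add.
Proof. by move=> f g; apply/fpsP => m /=; rewrite addrC. Qed.
Lemma fps_add0 : left_id fps0 fps_add.
Proof. by move=> f; apply/fpsP => m /=; rewrite add0r. Qed.
Lemma fps_addN : left_inverse fps0 fps_opp fps_add.
Proof. by move=> f; apply/fpsP => m /=; rewrite addNr. Qed.

HB.instance Definition _ :=
  GRing.isZmodule.Build (fps n K) fps_addA fps_addC fps_add0 fps_addN.

End Zmodule.

Section Ring.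
Variables (n : nat) (K : comNzRingType).
Implicit Types f g h : fps n K.

Definition fps1 : fps n K := Fps (fun m => (m == 0%MM)%:R).

Definition fps_mul f g : fps n K :=
  Fps (fun m => \sum_(k : 'X_{1..n < (mdeg m).+1, (mdeg m).+1}
                        | m == (k.1 + k.2)%MM) f k.1 * g k.2).

Definition fps_trunc d f : {mpoly K[n]} :=
  \sum_(k : 'X_{1..n < d}) f k *: 'X_[k].

Lemma fps_truncE d f m : (mdeg m < d)%N -> (fps_trunc d f)@_m = f m.
Proof. by move=> ltmd; rewrite (mcoeff_mpoly (fps_coef f) ltmd). Qed.

Lemma fps_mulE f g (p q : {mpoly K[n]}) m :
  (forall k, (mdeg k <= mdeg m)%N -> p@_k = f k) ->
  (forall k, (mdeg k <= mdeg m)%N -> q@_k = g k) ->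
  fps_mul f g m = (p * q)@_m.
Proof.
move=> pf qg; rewrite mcoeffM /=; apply: eq_bigr => -[k l] _ /=.
by rewrite pf ?qg // -ltnS bmdeg.
Qed.

Lemma fps_mulT f g d m : (mdeg m < d)%N ->
  fps_mul f g m = (fps_trunc d f * fps_trunc d g)@_m.
Proof.
move=> ltmd.
by apply: fps_mulE => k lekm; rewrite fps_truncE // (leq_ltn_trans lekm).
Qed.

Lemma fps_mulA : associative fps_mul.
Proof.
move=> f g h; apply/fpsP => m; set d := (mdeg m).+1.
have lt_d k : (mdeg k <= mdeg m)%N -> (mdeg k < d)%N by rewrite ltnS.
rewrite (@fps_mulE _ _ (fps_trunc d f) (fps_trunc d g * fps_trunc d h)).
- rewrite mulrA; apply/esym/fps_mulE => k /lt_d ltkd.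
    by rewrite (fps_mulT _ _ ltkd).
  by rewrite fps_truncE.
- by move=> k /lt_d; apply: fps_truncE.
- by move=> k /lt_d ltkd; rewrite (fps_mulT _ _ ltkd).
Qed.

Lemma fps_mulC : commutative fps_mul.
Proof.
move=> f g; apply/fpsP => m.
by rewrite !(fps_mulT _ _ (ltnSn _)) mulrC.
Qed.

Lemma fps_mul1 : left_id fps1 fps_mul.
Proof.
move=> f; apply/fpsP => m.
rewrite (@fps_mulE _ _ 1 (fps_trunc (mdeg m).+1 f)) => [||k].
- by rewrite mul1r fps_truncE.
- by move=> k _; rewrite mcoeff1.
- by move=> lekm; rewrite fps_truncE.
Qed.

Lemma fps_mulDl : left_distributive fps_mul (@fps_add n K).
Proof.
move=> f g h; apply/fpsP => m /=; rewrite -big_split /=.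
by apply: eq_bigr => k _; rewrite mulrDl.
Qed.

Lemma fps1_neq0 : fps1 != fps0 n K.
Proof.
apply/eqP => /fpsP /(_ 0%MM) /eqP /=.
by rewrite eqxx oner_eq0.
Qed.

HB.instance Definition _ := GRing.Zmodule_isComNzRing.Build (fps n K)
  fps_mulA fps_mulC fps_mul1 fps_mulDl fps1_neq0.

Definition fps_var (i : 'I_n) : fps n K := Fps (fun m => (m == U_(i)%MM)%:R).

Definition fps_deriv (j : 'I_n) f : fps n K :=
  Fps (fun m => f (m + U_(j))%MM *+ (m j).+1).

(* f(u_1, ..., u_n) = \sum_k f_k u^k. It is only meaningful when the u_i have no
   constant term: the monomial u^k then has order at least |k|, so that only the
   exponents k with |k| <= |m| contribute to the coefficient of z^m. *)
Definition fps_subst f (u : 'cV[fps n K]_n) : fps n K :=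
  Fps (fun m => \sum_(k : 'X_{1..n < (mdeg m).+1})
                   f k * (\prod_(i < n) u i 0 ^+ (k : 'X_{1..n}) i) m).

End Ring.

Section FormalDiffeomorphisms.
Variables (n : nat) (K : fieldType).
Implicit Types (f g h X : 'cV[fps n K]_n) (G : set 'cV[fps n K]_n).

Definition vanishes_at0 f := forall i, f i 0 0%MM = 0.

Definition jacobian f : 'M[fps n K]_n := \matrix_(i, j) fps_deriv j (f i 0).

(* f'(0) *)
Definition linear_part f : 'M[K]_n := map_mx (fun a : fps n K => a 0%MM) (jacobian f).

Definition formal_diffeo f := vanishes_at0 f /\ linear_part f \in unitmx.

Definition fcomp f g : 'cV[fps n K]_n := \col_i fps_subst (f i 0) g.

Definition fid : 'cV[fps n K]_n := \col_i @fps_var n K i.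

Definition is_finv f g :=
  [/\ formal_diffeo g, fcomp f g = fid & fcomp g f = fid].

(* The compositional inverse; fid if there is none, which never happens for a
   formal diffeomorphism. *)
Definition finv f : 'cV[fps n K]_n := xget fid [set g | is_finv f g].

Definition diffeo_subgroup G :=
  [/\ forall f, G f -> formal_diffeo f,
      G fid,
      forall f g, G f -> G g -> G (fcomp f g)
    & forall f, G f -> exists2 g, G g & is_finv f g].

Definition diffeo_abelian G :=
  forall f g, G f -> G g -> fcomp f g = fcomp g f.

Definition tangent_to_id f := linear_part f = 1%:M.

(* A vector field \sum_j X_j d/dz_j is the column of its components X_j. *)
Definition formal_vector_field X := vanishes_at0 X.

(* (Dg . X) o g^-1 *)
Definition pushforward g X : 'cV[fps n K]_n := fcomp (jacobian g *m X) (finv g).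

Definition invariant_field G X := forall g, G g -> pushforward g X = X.

End FormalDiffeomorphisms.

Arguments fid {n K}.

(* Main.v *)
(* If G contains an f <> id tangent to the identity, then X = log f is invariant.
   Write f^* for the pullback a |-> a o f. As f^* - 1 raises the order of a series,
   each coefficient of (f^t)^* a is a polynomial in t; let D a be its t-derivative
   at t = 0. Identities that hold for all t in nat are identities of polynomials:
   differentiating (f^t)^*(ab) = (f^t)^* a (f^t)^* b shows that D is a derivation,
   so D = \sum_j X_j d/dz_j with X_j = D z_j, and differentiating
   (f^t)^* g^* = g^* (f^t)^* for g in G gives D g^* = g^* D, that is, g_* X = X.
   Finally D = (f^* - 1)(1 + terms raising the order), so X = 0 forces f = id. *)
Require Import Defs.
From HB Require Import structures.
From mathcomp Require Import all_boot all_order all_algebra.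
From mathcomp Require Import boolp classical_sets reals complex mpoly.
Import GRing.Theory Num.Theory.
Local Open Scope ring_scope.

Set Implicit Arguments.
Unset Strict Implicit.
Unset Printing Implicit Defensive.

(** * Order of vanishing of power series *)

Section Order.
Variables (n : nat) (K : comNzRingType).
Implicit Types (a b : fps n K) (p q : {mpoly K[n]}) (m : 'X_{1..n}).

Lemma fpsDE a b m : (a + b) m = a m + b m. Proof. by []. Qed.
Lemma fpsNE a m : (- a) m = - a m. Proof. by []. Qed.
Lemma fpsBE a b m : (a - b) m = a m - b m. Proof. by []. Qed.
Lemma fps_sumE I (r : seq I) (P : pred I) (F : I -> fps n K) m :
  (\sum_(i <- r | P i) F i) m = \sum_(i <- r | P i) F i m.
Proof. by elim/big_rec2: _ => // i y x _ <-; rewrite fpsDE. Qed.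

Definition fps_of_mpoly p : fps n K := Fps (fun m => p@_m).

Fact fps_of_mpoly_is_additive : additive fps_of_mpoly.
Proof. by move=> p q; apply/fpsP => m /=; rewrite mcoeffB. Qed.

Fact fps_of_mpoly_is_multiplicative : multiplicative fps_of_mpoly.
Proof.
split=> [p q|]; apply/fpsP => m; last by rewrite /= mcoeff1.
exact/esym/(@fps_mulE n K (fps_of_mpoly p) (fps_of_mpoly q)).
Qed.

HB.instance Definition _ :=
  GRing.isAdditive.Build {mpoly K[n]} (fps n K) fps_of_mpoly
    fps_of_mpoly_is_additive.
HB.instance Definition _ :=
  GRing.isMultiplicative.Build {mpoly K[n]} (fps n K) fps_of_mpoly
    fps_of_mpoly_is_multiplicative.

Lemma fps_of_mpolyX i : fps_of_mpoly 'X_i = fps_var K i.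
Proof. by apply/fpsP => m /=; rewrite mcoeffX eq_sym. Qed.

Definition fps_const : K -> fps n K := fps_of_mpoly \o @mpolyC n K.
HB.instance Definition _ := GRing.RMorphism.on fps_const.

Lemma fps_constM c a m : (fps_const c * a) m = c * a m.
Proof.
rewrite (@fps_mulE _ _ _ _ c%:MP (fps_trunc (mdeg m).+1 a)) //.
  by rewrite mul_mpolyC mcoeffZ fps_truncE.
by move=> k lekm; rewrite fps_truncE.
Qed.

(** Membership in the [d]-th power of the ideal generated by the variables. Identities between
    series are proved modulo these powers, where series may be replaced by polynomials. *)
Definition ord_ge d a := forall m, (mdeg m < d)%N -> a m = 0.

Lemma ord_geW d e a : (d <= e)%N -> ord_ge e a -> ord_ge d a.
Proof. by move=> led ae m ltm; apply/ae/(leq_trans ltm). Qed.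

Lemma ord_geD d a b : ord_ge d a -> ord_ge d b -> ord_ge d (a + b).
Proof. by move=> ha hb m ltm; rewrite fpsDE ha // hb // addr0. Qed.

Lemma ord_geN d a : ord_ge d a -> ord_ge d (- a).
Proof. by move=> ha m ltm; rewrite fpsNE ha // oppr0. Qed.

Lemma ord_geB_eq d a b m : ord_ge d (a - b) -> (mdeg m < d)%N -> a m = b m.
Proof. by move=> h /h/eqP; rewrite fpsBE subr_eq0 => /eqP. Qed.

Lemma ord_geM d e a b : ord_ge d a -> ord_ge e b -> ord_ge (d + e) (a * b).
Proof.
move=> ha hb m ltm; apply: big1 => -[k l] /= /eqP def_m.
have [ltk|lek] := ltnP (mdeg k) d; first by rewrite ha // mul0r.
rewrite [b _]hb ?mulr0 // -(ltn_add2l d); apply: leq_ltn_trans ltm.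
by rewrite [X in (_ <= mdeg X)%N]def_m mdegD leq_add2r.
Qed.

Lemma ord_geMl d a b : ord_ge d b -> ord_ge d (a * b).
Proof. by move=> hb; apply: (@ord_geM 0%N). Qed.

Lemma ord_geX a d k : ord_ge d a -> ord_ge (d * k) (a ^+ k).
Proof.
move=> ha; elim: k => [|k IHk]; first by rewrite muln0.
by rewrite mulnS exprS; apply: ord_geM.
Qed.

Lemma ord_ge_prod (u : 'I_n -> fps n K) (d : 'I_n -> nat) :
  (forall i, ord_ge (d i) (u i)) ->
  ord_ge (\sum_(i < n) d i) (\prod_(i < n) u i).
Proof. by move=> hu; elim/big_rec2: _ => // i x y _ IH; apply: ord_geM. Qed.

Lemma ord_geMB d a a' b b' :
  ord_ge d (a - a') -> ord_ge d (b - b') -> ord_ge d (a * b - a' * b').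
Proof.
move=> ha hb.
have -> : a * b - a' * b' = b * (a - a') + a' * (b - b').
  by rewrite !mulrBr [b * a]mulrC [b * a']mulrC addrA subrK.
by apply: ord_geD; apply: ord_geMl.
Qed.

End Order.

(** * Substitution as a ring morphism *)

Section Substitution.
Variables (n : nat) (K : comNzRingType).
Implicit Types (a b : fps n K) (p q : {mpoly K[n]}) (m : 'X_{1..n}).
Implicit Types u v : 'cV[fps n K]_n.

(** Evaluation of polynomials is a ring morphism by construction; the multiplicativity of
    [fps_subst] is derived from it by truncation. *)
Definition mpoly_subst u : {mpoly K[n]} -> fps n K :=
  mmap (@fps_const n K) (fun i => u i 0).
HB.instance Definition _ u := GRing.RMorphism.on (mpoly_subst u).

Lemma mpoly_substC u c : mpoly_subst u c%:MP = fps_const n c.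
Proof. exact: mmapC. Qed.

Lemma mpoly_substZ u c p : mpoly_subst u (c *: p) = fps_const n c * mpoly_subst u p.
Proof. exact: mmapZ. Qed.

Lemma mpoly_substM u p q : mpoly_subst u (p * q) = mpoly_subst u p * mpoly_subst u q.
Proof. exact: rmorphM. Qed.

Lemma mpoly_substX u k : mpoly_subst u 'X_[k] = mmap1 (fun i => u i 0) k.
Proof. exact: mmapX. Qed.

Lemma mpoly_substXi u i : mpoly_subst u 'X_i = u i 0.
Proof. by rewrite mpoly_substX mmap1U. Qed.

Definition no_const u := forall i, ord_ge 1 (u i 0).

Lemma ord_ge_mmap1 u k : no_const u -> ord_ge (mdeg k) (mmap1 (fun i => u i 0) k).
Proof.
move=> hu; rewrite mdegE; apply: ord_ge_prod => i.
by rewrite -[X in ord_ge X]mul1n; apply: ord_geX.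
Qed.

Lemma ord_ge_mpoly_subst u p d : no_const u ->
  ord_ge d (fps_of_mpoly p) -> ord_ge d (mpoly_subst u p).
Proof.
move=> hu hp m ltm; rewrite fps_sumE big1 // => k _; rewrite fps_constM.
have [ltk|lek] := ltnP (mdeg k) d; first by rewrite [p@__](hp _ ltk) mul0r.
by rewrite ord_ge_mmap1 ?mulr0 //; apply: leq_trans lek.
Qed.

Lemma fps_subst_trunc u a m :
  fps_subst a u m = mpoly_subst u (fps_trunc (mdeg m).+1 a) m.
Proof.
rewrite raddf_sum fps_sumE; apply: eq_bigr => k _.
by rewrite /= mpoly_substZ mpoly_substX fps_constM.
Qed.

(** Terms of order above [|m|] stay so under [u], hence any polynomial close enough to [a] may
    replace it, such as the product of truncations in [fps_substM]. *)
Lemma fps_substE u a p m : no_const u ->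
  ord_ge (mdeg m).+1 (fps_of_mpoly p - a) -> fps_subst a u m = mpoly_subst u p m.
Proof.
move=> hu hp; rewrite fps_subst_trunc; apply/eqP; rewrite -subr_eq0 -fpsBE -rmorphB.
rewrite (@ord_ge_mpoly_subst _ _ (mdeg m).+1) // => k ltk.
rewrite rmorphB fpsBE /= fps_truncE //.
by have /eqP := hp k ltk; rewrite fpsBE subr_eq0 => /eqP/= ->; rewrite subrr.
Qed.

Lemma ord_ge_trunc d a : ord_ge d (fps_of_mpoly (fps_trunc d a) - a).
Proof. by move=> m ltm; rewrite fpsBE /= fps_truncE // subrr. Qed.

Lemma fps_subst_mpoly u p : no_const u ->
  fps_subst (fps_of_mpoly p) u = mpoly_subst u p.
Proof.
by move=> hu; apply/fpsP => m; apply: fps_substE => //; rewrite subrr.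
Qed.

Lemma ord_ge_subst u a d : no_const u -> ord_ge d a -> ord_ge d (fps_subst a u).
Proof.
(* As [|m| < d], the zero polynomial is close enough to [a]. *)
move=> hu ha m ltm; rewrite (@fps_substE _ _ 0) ?rmorph0 // sub0r.
by apply: ord_geN; apply: ord_geW ha.
Qed.

Lemma fps_substB u : {morph (fun a => fps_subst a u) : a b / a - b}.
Proof.
move=> a b; apply/fpsP => m /=; rewrite -sumrB.
by apply: eq_bigr => k _; rewrite -mulrBl.
Qed.

Lemma fps_substD u : {morph (fun a => fps_subst a u) : a b / a + b}.
Proof.
move=> a b; apply/fpsP => m /=; rewrite -big_split /=.
by apply: eq_bigr => k _; rewrite -mulrDl.
Qed.

Lemma fps_subst0 u : fps_subst 0 u = 0.
Proof. by apply/fpsP => m /=; apply: big1 => k _; rewrite mul0r. Qed.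

Lemma fps_substM u : no_const u ->
  {morph (fun a => fps_subst a u) : a b / a * b}.
Proof.
move=> hu a b; apply/fpsP => m; pose T := @fps_trunc n K (mdeg m).+1.
rewrite (@fps_substE _ _ (T a * T b)) //; last first.
  by rewrite rmorphM; apply: ord_geMB; apply: ord_ge_trunc.
rewrite mpoly_substM -!fps_subst_mpoly //; apply: (ord_geB_eq (d := (mdeg m).+1)) => //.
apply: ord_geMB; rewrite -fps_substB;
  by apply: ord_ge_subst => //; apply: ord_ge_trunc.
Qed.

Lemma fps_subst_var u i : no_const u -> fps_subst (fps_var K i) u = u i 0.
Proof.
by move=> hu; rewrite -fps_of_mpolyX fps_subst_mpoly // mpoly_substXi.
Qed.

Lemma fps_subst_const u c : no_const u -> fps_subst (fps_const n c) u = fps_const n c.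
Proof. by move=> hu; rewrite fps_subst_mpoly // mpoly_substC. Qed.

Lemma fps_subst1 u : no_const u -> fps_subst 1 u = 1.
Proof. by move=> hu; have := fps_subst_const 1 hu; rewrite rmorph1. Qed.

Lemma fps_subst_sum u I (r : seq I) (F : I -> fps n K) :
  fps_subst (\sum_(i <- r) F i) u = \sum_(i <- r) fps_subst (F i) u.
Proof. exact: (big_morph _ (fps_substD u) (fps_subst0 u)). Qed.

Lemma fps_subst_prod u I (r : seq I) (F : I -> fps n K) : no_const u ->
  fps_subst (\prod_(i <- r) F i) u = \prod_(i <- r) fps_subst (F i) u.
Proof. by move=> hu; apply: (big_morph _ (fps_substM hu) (fps_subst1 hu)). Qed.

Lemma fps_substX u a k : no_const u -> fps_subst (a ^+ k) u = fps_subst a u ^+ k.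
Proof.
move=> hu; elim: k => [|k IHk]; first by rewrite !expr0 fps_subst1.
by rewrite !exprS fps_substM // IHk.
Qed.

(** Suited to ring morphisms and derivations, which are determined by their values on constants and
    variables. *)
Lemma mpoly_ring_ind (P : {mpoly K[n]} -> Prop) :
  (forall c, P c%:MP) -> (forall i, P 'X_i) ->
  (forall p q, P p -> P q -> P (p + q)) ->
  (forall p q, P p -> P q -> P (p * q)) -> forall p, P p.
Proof.
move=> PC PX PD PM p; rewrite [p]mpolyE; elim/big_ind: _ => // [|k _].
  by rewrite -mpolyC0.
rewrite -mul_mpolyC; apply: (PM) => //; rewrite mpolyXE_id.
elim/big_ind: _ => // [|i _]; first by rewrite -mpolyC1.
by elim: (k i) => [|e IHe]; rewrite ?expr0 -?mpolyC1 // exprS; apply: PM.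
Qed.

End Substitution.

(** * Composition of formal maps *)

Section Composition.
Variables (n : nat) (K : fieldType).
Implicit Types (a b : fps n K) (p q : {mpoly K[n]}) (m : 'X_{1..n}).
Implicit Types u v : 'cV[fps n K]_n.

Lemma no_const_fid : no_const (@fid n K).
Proof.
move=> i m /=; rewrite ltnS leqn0 mxE /= => /eqP.
by case: eqP => // -> /eqP; rewrite mdeg1.
Qed.

Lemma fps_subst_id a : fps_subst a fid = a.
Proof.
have subst_id p : mpoly_subst fid p = fps_of_mpoly p.
  elim/mpoly_ring_ind: p => [c|i|p q IHp IHq|p q IHp IHq].
  - exact: mpoly_substC.
  - by rewrite mpoly_substXi mxE fps_of_mpolyX.
  - by rewrite !rmorphD /= IHp IHq.
  - by rewrite !rmorphM /= IHp IHq.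
apply/fpsP => m; rewrite (fps_substE no_const_fid (@ord_ge_trunc _ _ _ a)).
by rewrite subst_id /= fps_truncE.
Qed.

Lemma no_const_fcomp u v : no_const u -> no_const v -> no_const (fcomp u v).
Proof. by move=> hu hv i; rewrite mxE; apply: ord_ge_subst. Qed.

Lemma fps_subst_mpoly_subst u v p : no_const v ->
  fps_subst (mpoly_subst u p) v = mpoly_subst (fcomp u v) p.
Proof.
move=> hv; rewrite /mpoly_subst /mmap fps_subst_sum; apply: eq_bigr => k _.
rewrite fps_substM // fps_subst_const // /mmap1 fps_subst_prod //; congr (_ * _).
by apply: eq_bigr => i _; rewrite fps_substX // mxE.
Qed.

(** For polynomials this is [fps_subst_mpoly_subst]; the truncation error of [a] keeps its order
    under both substitutions. *)
Lemma fps_substA a u v : no_const u -> no_const v ->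
  fps_subst (fps_subst a u) v = fps_subst a (fcomp u v).
Proof.
move=> hu hv; apply/fpsP => m; set p := fps_trunc (mdeg m).+1 a.
have hp : ord_ge (mdeg m).+1 (fps_of_mpoly p - a) by apply: ord_ge_trunc.
rewrite (fps_substE (no_const_fcomp hu hv) hp) -fps_subst_mpoly_subst //.
rewrite -fps_subst_mpoly //; apply/esym/(ord_geB_eq (d := (mdeg m).+1)) => //.
by rewrite -!fps_substB; do 2!apply: ord_ge_subst => //.
Qed.

Lemma fcompA u v w : no_const v -> no_const w ->
  fcomp (fcomp u v) w = fcomp u (fcomp v w).
Proof.
by move=> hv hw; apply/matrixP => i j; rewrite !mxE fps_substA.
Qed.

Lemma fcompf1 u : fcomp u fid = u.
Proof. by apply/matrixP => i j; rewrite !mxE fps_subst_id (ord1 j). Qed.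

End Composition.

(** * Partial derivatives *)

Section Derivative.
Variables (n : nat) (K : comNzRingType).
Implicit Types (a b : fps n K) (p q : {mpoly K[n]}) (m : 'X_{1..n}) (j : 'I_n).

Lemma fps_derivB j : {morph @fps_deriv n K j : a b / a - b}.
Proof. by move=> a b; apply/fpsP => m /=; rewrite mulrnBl. Qed.

Lemma fps_deriv_mpoly j p : fps_deriv j (fps_of_mpoly p) = fps_of_mpoly p^`M(j).
Proof. by apply/fpsP => m /=; rewrite mcoeff_deriv. Qed.

Lemma ord_ge_deriv j d a : ord_ge d.+1 a -> ord_ge d (fps_deriv j a).
Proof. by move=> ha m ltm /=; rewrite ha ?mul0rn // mdegD mdeg1 addn1. Qed.

End Derivative.

(** * Binomial coefficients as polynomials *)

Section Binomial.
Variable K : numFieldType.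

(** The binomial coefficient [t] choose [k] as a polynomial in [t], so that it can be differentiated
    in [t]. *)
Definition binomial_poly k : {poly K} :=
  (k`!%:R)^-1 *: \prod_(i < k) ('X - i%:R%:P).

Lemma binomial_polyE k t : (binomial_poly k).[t%:R] = 'C(t, k)%:R.
Proof.
have fact_neq0 : (k`!%:R : K) != 0 by rewrite pnatr_eq0 -lt0n fact_gt0.
apply: (mulfI fact_neq0); rewrite hornerZ mulVKf // mulrC -natrM bin_ffact.
elim: k {fact_neq0} => [|k IHk]; first by rewrite big_ord0 hornerC.
rewrite big_ord_recr hornerM /= IHk hornerXsubC ffactnSr natrM.
(* Subtraction in [nat] agrees with that of [K] only for [k <= t]; otherwise the falling factorial
   is already zero. *)
have [lekt|ltkt] := leqP k t; first by rewrite natrB.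
by rewrite ffact_small // !mul0r.
Qed.

Lemma binomial_poly0 : binomial_poly 0 = 1.
Proof. by rewrite /binomial_poly big_ord0 fact0 invr1 scale1r. Qed.

Lemma binomial_poly1 : binomial_poly 1 = 'X.
Proof. by rewrite /binomial_poly big_ord1 invr1 scale1r subr0. Qed.

(** In characteristic zero the naturals are infinitely many distinct points, too many roots for a
    nonzero [p - q]. *)
Lemma poly_eq_nat (p q : {poly K}) :
  (forall t : nat, p.[t%:R] = q.[t%:R]) -> p = q.
Proof.
move=> eqpq; apply/eqP; rewrite -subr_eq0; apply/eqP.
apply: (@roots_geq_poly_eq0 _ _ [seq t%:R | t <- iota 0 (size (p - q))]).
- by apply/allP => _ /mapP[t _ ->]; rewrite rootE hornerD hornerN eqpq subrr.
- by rewrite map_inj_uniq ?iota_uniq // => s t /eqP; rewrite eqr_nat => /eqP.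
- by rewrite size_map size_iota.
Qed.

End Binomial.

(** * Leading homogeneous parts *)

Section LeadingPart.
Variables (n : nat) (K : comNzRingType).
Implicit Types (a b : fps n K).

(** Equal homogeneous parts of degree [d] and nothing below; bounding both orders makes the relation
    stable under products. *)
Definition eq_lead d a b := [/\ ord_ge d a, ord_ge d b & ord_ge d.+1 (a - b)].

Lemma eq_leadM d e a a' b b' :
  eq_lead d a b -> eq_lead e a' b' -> eq_lead (d + e) (a * a') (b * b').
Proof.
move=> [ha hb hab] [ha' hb' hab']; split; try exact: ord_geM.
have -> : a * a' - b * b' = (a - b) * a' + b * (a' - b').
  by rewrite mulrBl mulrBr addrA subrK.
apply: ord_geD; first exact: (@ord_geM _ _ d.+1).
by rewrite -addnS; apply: ord_geM.
Qed.

Lemma eq_lead1 : eq_lead 0 1 1.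
Proof. by split=> //; rewrite subrr. Qed.

End LeadingPart.

(** * The logarithm of a map tangent to the identity *)

Section Logarithm.
Variables (n : nat) (K : numFieldType) (f : 'cV[fps n K]_n).
Hypothesis f_tangent : forall i, ord_ge 2 (f i 0 - fps_var K i).
Implicit Types (a b : fps n K) (p q : {mpoly K[n]}) (m : 'X_{1..n}).

Lemma fidE i : (fid : 'cV[fps n K]_n) i 0 = fps_var K i.
Proof. by rewrite mxE. Qed.

Lemma tangent_no_const : no_const f.
Proof.
move=> i; rewrite -[f i 0](subrK (fps_var K i)); apply: ord_geD.
  exact: ord_geW (f_tangent i).
by rewrite -fidE; apply: no_const_fid.
Qed.

(** Each [f_i] has leading part [z_i], and leading parts multiply. *)
Lemma tangent_mmap1 k :
  ord_ge (mdeg k).+1 (mmap1 (fun i => f i 0) k - mmap1 (fun i => (@fid n K) i 0) k).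
Proof.
suff: eq_lead (mdeg k) (mmap1 (fun i => f i 0) k) (mmap1 (fun i => (@fid n K) i 0) k).
  by case.
rewrite mdegE /mmap1; elim/big_rec3: _ => [|i d a b _]; first exact: eq_lead1.
apply: eq_leadM.
elim: (k i) => [|e IHe]; first by rewrite !expr0; apply: eq_lead1.
rewrite !exprS -[e.+1]add1n; apply: eq_leadM IHe; split.
- exact: tangent_no_const.
- exact: no_const_fid.
- by rewrite fidE.
Qed.

Definition pull a := fps_subst a f.
Definition delta a := pull a - a.

Lemma pullD a b : pull (a + b) = pull a + pull b.
Proof. exact: fps_substD. Qed.

Lemma ord_ge_delta d a : ord_ge d a -> ord_ge d.+1 (delta a).
Proof.
(* With [a] written as [a o id], the difference is the sum of the [a_k (f^k - z^k)], whose terms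
   have order above [|k|]. *)
move=> ha m; rewrite ltnS => lemd; rewrite /delta -[X in pull a - X]fps_subst_id.
rewrite /pull fpsBE -sumrB big1 // => k _; rewrite -mulrBr.
have [ltkd|ledk] := ltnP (mdeg k) d; first by rewrite ha // mul0r.
have ltmk : (mdeg m < (mdeg k).+1)%N by rewrite ltnS (leq_trans lemd).
by have := tangent_mmap1 ltmk; rewrite fpsBE /mmap1 => ->; rewrite mulr0.
Qed.

Lemma ord_ge_iter_delta k d a : ord_ge d a -> ord_ge (k + d) (iter k delta a).
Proof. by move=> ha; elim: k => // k IHk; apply: ord_ge_delta. Qed.

Lemma iter_pullD t a b : iter t pull (a + b) = iter t pull a + iter t pull b.
Proof. by elim: t => // t IHt; rewrite !iterS IHt pullD. Qed.

Lemma ord_ge_iter_pull t d a : ord_ge d a -> ord_ge d (iter t pull a).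
Proof.
by move=> ha; elim: t => // t IHt; apply: ord_ge_subst => //; apply: tangent_no_const.
Qed.

(* The expansion (1 + delta)^t = \sum_k 'C(t, k) delta^k, cut off where delta^k a
   no longer contributes to the coefficient at m. *)
Lemma iter_pullE t s m a : ord_ge ((mdeg m).+1 - s) a ->
  iter t pull a m = \sum_(k < s) iter k delta a m *+ 'C(t, k).
Proof.
elim: t s a => [|t IHt] [|s] a ha.
- by rewrite big_ord0 ha // subn0.
- by rewrite big_ord_recl bin0 big1 ?addr0.
- by rewrite big_ord0; apply: (@ord_ge_iter_pull _ (mdeg m).+1).
(* Since [pull a = delta a + a] and [delta] raises the order, the part from [delta a] takes one term
   fewer; Pascal's rule recombines the two sums. *)
rewrite iterSr -[pull a](subrK a) iter_pullD fpsDE (IHt s); last first.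
  have := ord_ge_delta ha; apply: ord_geW; rewrite subSS.
  by rewrite leq_subLR addnS ltnS -leq_subLR.
rewrite (IHt s.+1) // !big_ord_recl !bin0 addrCA; congr (_ + _).
rewrite -big_split; apply: eq_bigr => k _; rewrite lift0 binS mulrnDr [RHS]addrC.
by rewrite !iterSr.
Qed.

(** The coefficient at [m] of the pullback of [a] by the [t]-th iterate of [f], as a polynomial in
    [t]. As [delta^k a] has order at least [k], the terms with [k > |m|] vanish; the bound [|m| + 2]
    guarantees the terms [k = 0] and [k = 1] even for [m = 0]. *)
Definition flow_poly a m : {poly K} :=
  \sum_(k < (mdeg m).+2) iter k delta a m *: binomial_poly K k.

Lemma flow_polyE a m t : (flow_poly a m).[t%:R] = iter t pull a m.
Proof.
rewrite (@iter_pullE _ (mdeg m).+2); last by rewrite (eqP (leqnSn _)).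
rewrite horner_sum; apply: eq_bigr => k _.
by rewrite hornerZ binomial_polyE mulr_natr.
Qed.

(** Transfers facts on the iterates of [pull] to [flow_poly]. *)
Lemma flow_poly_eq (P : {poly K}) a m :
  (forall t : nat, P.[t%:R] = iter t pull a m) -> flow_poly a m = P.
Proof. by move=> hP; apply: poly_eq_nat => t; rewrite hP flow_polyE. Qed.

Lemma flow_polyB a b m : flow_poly (a - b) m = flow_poly a m - flow_poly b m.
Proof.
apply: flow_poly_eq => t; rewrite hornerD hornerN !flow_polyE.
by have := iter_pullD t (a - b) b; rewrite subrK => ->; rewrite fpsDE addrK.
Qed.

Lemma flow_polyM a b m : flow_poly (a * b) m =
  \sum_(k : 'X_{1..n < (mdeg m).+1, (mdeg m).+1} | m == (k.1 + k.2)%MM)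
     flow_poly a k.1 * flow_poly b k.2.
Proof.
apply: flow_poly_eq => t; rewrite horner_sum.
have -> : iter t pull (a * b) = iter t pull a * iter t pull b.
  elim: t => // t IHt; rewrite !iterS IHt.
  exact/fps_substM/tangent_no_const.
by apply: eq_bigr => k _; rewrite hornerM !flow_polyE.
Qed.

Lemma flow_poly_const c m : flow_poly (fps_const n c) m = (fps_const n c m)%:P.
Proof.
apply: flow_poly_eq => t; rewrite hornerC; congr (fps_coef _ m).
elim: t => // t IHt; rewrite iterS -IHt /pull fps_subst_const //.
exact: tangent_no_const.
Qed.

(** The pullbacks by [f] and [g] commute, and the coefficients of a substitution by [g] are linear
    in those of [a], with weights independent of [t]. *)
Lemma flow_poly_subst g a m : no_const g -> fcomp f g = fcomp g f ->
  flow_poly (fps_subst a g) m =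
  \sum_(k : 'X_{1..n < (mdeg m).+1}) mmap1 (fun i => g i 0) k m *: flow_poly a k.
Proof.
move=> hg fg; apply: flow_poly_eq => t; rewrite horner_sum.
have -> : iter t pull (fps_subst a g) = fps_subst (iter t pull a) g.
  elim: t => // t IHt; rewrite !iterS IHt /pull !fps_substA ?fg //;
    exact: tangent_no_const.
by apply: eq_bigr => k _; rewrite hornerZ flow_polyE mulrC.
Qed.

Lemma ord_ge_flow_poly d a m : ord_ge d a -> (mdeg m < d)%N -> flow_poly a m = 0.
Proof.
move=> ha ltm; apply: flow_poly_eq => t.
by rewrite horner0 (ord_ge_iter_pull _ ha).
Qed.

(* The t-derivative at 0 of the pullback by the t-th iterate of f, that is, the
   logarithm of the pullback by f. *)
Definition log_deriv a : fps n K := Fps (fun m => (flow_poly a m)^`().[0]).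

(** The series of [log (1 + delta)]: the constant is 0 for [k = 0] and [(-1)^(k-1) / k] for
    [k >= 1]. *)
Lemma log_deriv_sum a m : log_deriv a m =
  \sum_(0 <= k < (mdeg m).+2) iter k delta a m * (binomial_poly K k)^`().[0].
Proof.
rewrite big_mkord -[LHS]/((flow_poly a m)^`().[0]) /flow_poly raddf_sum horner_sum.
by apply: eq_bigr => k _; rewrite -hornerZ -derivZ.
Qed.

Lemma log_derivB : {morph log_deriv : a b / a - b}.
Proof.
by move=> a b; apply/fpsP => m /=; rewrite flow_polyB derivB hornerD hornerN.
Qed.

Lemma log_derivD : {morph log_deriv : a b / a + b}.
Proof.
by move=> a b; have := log_derivB (a + b) b; rewrite addrK => ->; rewrite subrK.
Qed.

Lemma flow_poly_at0 a m : (flow_poly a m).[0] = a m.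
Proof. exact: (flow_polyE a m 0). Qed.

(** The product rule for polynomials in [t], taken at [t = 0], where [flow_poly a m] has the value
    [a m]. *)
Lemma log_derivM a b : log_deriv (a * b) = log_deriv a * b + a * log_deriv b.
Proof.
apply/fpsP => m; rewrite fpsDE /= flow_polyM raddf_sum horner_sum -big_split.
by apply: eq_bigr => k _; rewrite /= derivM hornerD !hornerM !flow_poly_at0.
Qed.

Lemma log_deriv_const c : log_deriv (fps_const n c) = 0.
Proof. by apply/fpsP => m /=; rewrite flow_poly_const derivC horner0. Qed.

Lemma log_deriv_subst g a : no_const g -> fcomp f g = fcomp g f ->
  log_deriv (fps_subst a g) = fps_subst (log_deriv a) g.
Proof.
move=> hg fg; apply/fpsP => m /=; rewrite flow_poly_subst // raddf_sum horner_sum.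
by apply: eq_bigr => k _; rewrite /= derivZ hornerZ mulrC.
Qed.

Lemma ord_ge_log_deriv d a : ord_ge d a -> ord_ge d (log_deriv a).
Proof. by move=> ha m ltm /=; rewrite (ord_ge_flow_poly ha) // deriv0 horner0. Qed.

Definition log_field : 'cV[fps n K]_n := \col_i log_deriv (fps_var K i).

(** A derivation that kills constants is determined on polynomials by its values on the
    variables. *)
Lemma log_deriv_mpoly p : log_deriv (fps_of_mpoly p) =
  \sum_(j < n) fps_of_mpoly p^`M(j) * log_field j 0.
Proof.
elim/mpoly_ring_ind: p => [c|i|p q IHp IHq|p q IHp IHq].
- rewrite [LHS]log_deriv_const big1 // => j _.
  by rewrite mderivC rmorph0 mul0r.
- rewrite (bigD1 i) //= big1 ?addr0 => [|j neqji].
    have subUU : (U_(i) - U_(i))%MM = 0%MM :> 'X_{1..n}.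
      by apply/mnmP => k; rewrite mnmBE subnn mnm0E.
    rewrite mderivX mnm1E eqxx scale1r subUU mpolyX0 rmorph1 mul1r mxE.
    by rewrite fps_of_mpolyX.
  by rewrite mderivX mnm1E eq_sym (negPf neqji) scale0r rmorph0 mul0r.
- rewrite rmorphD /= log_derivD IHp IHq -big_split.
  by apply: eq_bigr => j _; rewrite mderivD rmorphD mulrDl.
- rewrite rmorphM /= log_derivM IHp IHq mulr_suml mulr_sumr -big_split.
  apply: eq_bigr => j _; rewrite mderivM rmorphD !rmorphM /= mulrDl mulrA.
  by congr (_ + _); rewrite mulrAC.
Qed.

Lemma log_derivE a : log_deriv a = \sum_(j < n) fps_deriv j a * log_field j 0.
Proof.
(* Degree [|m| + 1] must be kept, since [fps_deriv] lowers the degree by one. *)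
apply/fpsP => m; set p := fps_trunc (mdeg m).+2 a.
have hp : ord_ge (mdeg m).+2 (fps_of_mpoly p - a) by apply: ord_ge_trunc.
apply/esym; transitivity (log_deriv (fps_of_mpoly p) m); last first.
  apply: (ord_geB_eq (d := (mdeg m).+1)) => //; rewrite -log_derivB.
  by apply: ord_ge_log_deriv; apply: ord_geW hp.
rewrite log_deriv_mpoly !fps_sumE; apply: eq_bigr => j _; apply/esym.
apply: (ord_geB_eq (d := (mdeg m).+1)) => //; rewrite -mulrBl mulrC.
apply: ord_geMl; rewrite -fps_deriv_mpoly -fps_derivB.
exact: ord_ge_deriv.
Qed.

Lemma log_field_vanishes : vanishes_at0 log_field.
Proof.
move=> i; rewrite mxE; apply: (@ord_ge_log_deriv 1); last by rewrite mdeg0.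
by rewrite -fidE; apply: no_const_fid.
Qed.

(** With [D = log_deriv], the series [D g_i] is computed twice: by [log_derivE], and as
    [D (z_i o g) = (D z_i) o g]. *)
Lemma log_field_invariant g : no_const g -> fcomp f g = fcomp g f ->
  jacobian g *m log_field = fcomp log_field g.
Proof.
move=> hg fg; apply/matrixP => i j; rewrite (ord1 j) [LHS]mxE [RHS]mxE.
rewrite [in RHS]mxE -log_deriv_subst // fps_subst_var // log_derivE.
by apply: eq_bigr => k _; rewrite mxE.
Qed.

(* log(1 + delta) = delta (1 + ...) where the omitted terms raise the order. *)
Lemma log_field_eq0 : log_field = 0 -> f = fid.
Proof.
move=> X0; apply/matrixP => i j; rewrite (ord1 j) fidE.
rewrite -(fps_subst_var i tangent_no_const).
apply/eqP; rewrite -subr_eq0; apply/eqP.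
have [h def_h] : exists h, delta (fps_var K i) = h by exists (delta (fps_var K i)).
rewrite -[LHS]/(delta (fps_var K i)) def_h.
(* If [h] has order at least [d], then [delta^k h] with [k >= 1] has no term of degree [d]; there
   the coefficient of [log_field i 0], which is zero, is that of [h]. *)
suff hh d : ord_ge d h by apply/fpsP => m; apply: (hh (mdeg m).+1).
elim: d => // d IHd m; rewrite ltnS leq_eqVlt => /predU1P[eqmd|]; last exact: IHd.
have : log_field i 0 m = 0 by rewrite X0 mxE.
rewrite mxE log_deriv_sum !big_nat_recl // big1 => [|k _].
  rewrite addr0 binomial_poly0 binomial_poly1 derivC derivX horner0 mulr0 add0r.
  by rewrite hornerC mulr1 iterS def_h.
have ltmk : (mdeg m < k.+1 + d)%N by rewrite eqmd addSn ltnS leq_addl.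
by rewrite iterSr def_h (ord_ge_iter_delta IHd ltmk) mul0r.
Qed.

End Logarithm.

(** * From commutation to invariance under the group *)

Section InvariantField.
Variables (n : nat) (K : numFieldType).
Implicit Types (f g X : 'cV[fps n K]_n).

Lemma formal_diffeo_no_const f : formal_diffeo f -> no_const f.
Proof.
by move=> [f0 _] i m; rewrite ltnS leqn0 mdeg_eq0 => /eqP ->; apply: f0.
Qed.

(** The degree-one coefficients of [f_i] form the [i]-th row of [linear_part f], those of [z_i] the
    [i]-th row of the identity matrix. *)
Lemma tangent_to_id_ord f : vanishes_at0 f -> tangent_to_id f ->
  forall i, ord_ge 2 (f i 0 - fps_var K i).
Proof.
move=> f0 f1 i m; rewrite ltnS leq_eqVlt ltnS leqn0 => /orP[|].
  rewrite mdeg_eq1 => /existsP[j /eqP ->].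
  have /matrixP/(_ i j) := f1; rewrite !mxE /= mnm0E mulr1n add0m => ->.
  by rewrite eq_mnm1 [j == i]eq_sym subrr.
rewrite mdeg_eq0 => /eqP ->; rewrite fpsBE f0 /=.
by rewrite eq_sym -mdeg_eq0 mdeg1 subrr.
Qed.

Lemma pushforward_fixed g X : formal_diffeo g -> (exists h, is_finv g h) ->
  jacobian g *m X = fcomp X g -> pushforward g X = X.
Proof.
(* The existence of an inverse ensures that [finv g] is one, and not merely the default value
   [fid]. *)
move=> hg /(xgetPex (@fid n K)) [hinv ginv _] gX.
rewrite /pushforward gX fcompA; [|exact: formal_diffeo_no_const..].
by rewrite [fcomp g _]ginv fcompf1.
Qed.

End InvariantField.

Theorem theorem1p9 (R : realType) (n : nat) (hn : (1 <= n)%N)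
    (G : set 'cV[fps n R[i]]_n) (hG : diffeo_subgroup G)
    (hab : diffeo_abelian G) :
  (exists X : 'cV[fps n R[i]]_n,
     [/\ formal_vector_field X, X <> 0 & invariant_field G X])
  \/ (forall f : 'cV[fps n R[i]]_n, G f -> tangent_to_id f -> f = fid).
Proof.
(* Excluded middle: either some [f <> fid] in [G] is tangent to the identity, and its logarithm is
   the field, or the second alternative holds. *)
have [[f [Gf tf nf]]|nof] :=
  pselect (exists f, [/\ G f, tangent_to_id f & f <> fid]); [left | right].
  have [Gdiff _ _ Ginv] := hG.
  have f_tangent := tangent_to_id_ord (proj1 (Gdiff f Gf)) tf.
  exists (log_field f); split; first exact: log_field_vanishes.
    by move=> X0; apply/nf/log_field_eq0.
  move=> g Gg; have dg := Gdiff g Gg; apply: pushforward_fixed => //.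
    by have [h _ gh] := Ginv g Gg; exists h.
  by apply: log_field_invariant (formal_diffeo_no_const dg) _ => //; apply: hab.
by move=> f Gf tf; apply: contrapT => nf; apply: nof; exists f.
Qed.
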